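(* Let $(G,o)$ be a Menger algebra of rank $n$ and let $\varepsilon$ be an $lv$-cancellative congruence on $(G,o)$. Then each $\varepsilon$-class $X$ is bistrong and $\varepsilon\subseteq\mathcal{P}_X$. Moreover, the relations $\varepsilon$ and $\mathcal{P}_X$ coincide on $G\setminus W^X$, i.e. $\varepsilon\cap\big((G\setminus W^X)\times(G\setminus W^X)\big)=\mathcal{P}_X\cap\big((G\setminus W^X)\times(G\setminus W^X)\big)$.
   Context: Let $n$ be a positive integer. A Menger algebra $(G,o)$ of rank $n$ is a nonempty set $G$ with an $(n+1)$-ary operation $o:(f,g_1,\ldots,g_n)\mapsto f[g_1\ldots g_n]$ satisfying the superassociative law $f[g_1\ldots g_n][h_1\ldots h_n]=f[g_1[h_1\ldots h_n]\ldots g_n[h_1\ldots h_n]]$ for all $f,g_i,h_i\in G$. For $u,x\in G$, $\overline{w}=(w_1,\ldots,w_n)\in G^n$ and $1\le i\le n$, $u[\overline{w}|_i x]$ denotes $u[w_1\ldots w_{i-1}\,x\,w_{i+1}\ldots w_n]$. Put $B=G^n\cup\{\overline{e}\}$, where $\overline{e}=(e_1,\ldots,e_n)$ is a tuple of pairwise different formal symbols not in $G$. For $g\in G$ and $\overline{x}=(x_1,\ldots,x_n)\in G^n$ write $g[\overline{x}]=g[x_1\ldots x_n]$, and put $g[\overline{e}]=g$. $T_n(G)$ is the smallest set of polynomials in one variable $x$ such that $x\in T_n(G)$ and, whenever $i\in\{1,\ldots,n\}$, $a,b_1,\ldots,b_{i-1},b_{i+1},\ldots,b_n\in G$ and $t\in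 T_n(G)$, also $a[b_1\ldots b_{i-1}\,t\,b_{i+1}\ldots b_n]\in T_n(G)$. Each $t\in T_n(G)$ is identified with the map $G\to G$, $x\mapsto t(x)$, it defines. A relation $\rho\subseteq G\times G$ is stable if $(x,y),(x_1,y_1),\ldots,(x_n,y_n)\in\rho$ implies $(x[x_1\ldots x_n],y[y_1\ldots y_n])\in\rho$; a congruence is a stable equivalence relation. The relation $\rho$ is $l$-cancellative if for all $x,y\in G$ and $(z_1,\ldots,z_n)\in G^n$, $(x[z_1\ldots z_n],y[z_1\ldots z_n])\in\rho$ implies $(x,y)\in\rho$; $v$-cancellative if for all $x,y,u\in G$, $\overline{w}\in G^n$, $i=1,\ldots,n$, $(u[\overline{w}|_i x],u[\overline{w}|_i y])\in\rho$ implies $(x,y)\in\rho$; and $lv$-cancellative if it is both $l$-cancellative and $v$-cancellative. An $\varepsilon$-class is an equivalence class of $\varepsilon$. For $X\subseteq G$ and $g\in G$ put $\sigma_X\langle g\rangle=\{(\overline{x},t)\in B\times T_n(G)\mid t(g[\overline{x}])\in X\}$, $W^X=\{g\in G\mid\sigma_X\langle g\rangle=\varnothing\}$, and $\mathcal{P}_X=\{(g_1,g_2)\in G\times G\mid\sigma_X\langle g_1\rangle=\sigma_X\langle g_2\rangle\}$. The subset $X$ is bistrong if for all $a,b\in G$, $\sigma_X\langle a\rangle\cap\sigma_X\langle b\rangle\neq\varnothing$ implies $\sigma_X\langle a\rangle=\sigma_X\langle b\rangle$. *)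

(* Defs.v *)
From mathcomp Require Import all_boot.
From mathcomp Require Import boolp classical_sets.

Set Implicit Arguments.
Unset Strict Implicit.
Unset Printing Implicit Defensive.

Local Open Scope classical_set_scope.

(* [mop f g] is f[g_1 ... g_n]; an element of G^n is a finite function
   on 'I_n, so the indices 1..n become 0..n-1. *)
Record mengerAlgebra (n : nat) := MengerAlgebra {
  carrier :> Type;
  mop : carrier -> {ffun 'I_n -> carrier} -> carrier;
  menger_inhabited : inhabited carrier;
  superassociative : forall (f : carrier) (g h : {ffun 'I_n -> carrier}),
    mop (mop f g) h = mop f [ffun i => mop (g i) h] }.

Section Menger.
Variables (n : nat) (G : mengerAlgebra n).
Implicit Types (rho eps : set (G * G)) (X : set G).

(* u[w |_i x]; the value [w i] is irrelevant. *)
Definition mop_at (u : G) (w : {ffun 'I_n -> G}) (i : 'I_n) (x : G) : G :=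
  mop u [ffun j => if j == i then x else w j].

(* B = G^n with one extra element: [None] is the tuple of formal symbols
   (e_1, ..., e_n), which acts by g[e] = g. *)
Definition extvec : Type := option {ffun 'I_n -> G}.

Definition extmop (g : G) (b : extvec) : G :=
  if b is Some x then mop g x else g.

(* T_n(G), with polynomials identified with the maps they define. *)
Inductive Tn : set (G -> G) :=
| Tn_var : Tn (fun x => x)
| Tn_comp (i : 'I_n) (a : G) (b : {ffun 'I_n -> G}) (t : G -> G) :
    Tn t -> Tn (fun x => mop_at a b i (t x)).

Definition stable rho : Prop :=
  forall (x y : G) (xs ys : {ffun 'I_n -> G}),
    rho (x, y) -> (forall i, rho (xs i, ys i)) -> rho (mop x xs, mop y ys).

Definition congruence rho : Prop :=
  RelationClasses.Equivalence (fun x y => rho (x, y)) /\ stable rho.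

Definition l_cancellative rho : Prop :=
  forall (x y : G) (z : {ffun 'I_n -> G}),
    rho (mop x z, mop y z) -> rho (x, y).

Definition v_cancellative rho : Prop :=
  forall (x y u : G) (w : {ffun 'I_n -> G}) (i : 'I_n),
    rho (mop_at u w i x, mop_at u w i y) -> rho (x, y).

Definition lv_cancellative rho : Prop :=
  l_cancellative rho /\ v_cancellative rho.

Definition is_class eps X : Prop :=
  exists g : G, X = [set y | eps (g, y)].

Definition sigma X (g : G) : set (extvec * (G -> G)) :=
  [set p | Tn p.2 /\ X (p.2 (extmop g p.1))].

Definition Wset X : set G := [set g | sigma X g = set0].

Definition Prel X : set (G * G) := [set p | sigma X p.1 = sigma X p.2].

Definition bistrong X : Prop :=
  forall a b : G, sigma X a `&` sigma X b !=set0 -> sigma X a = sigma X b.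

End Menger.

(* Main.v *)
(* A translation t of T_n(G) preserves a stable reflexive relation and, under
   v-cancellativity, reflects it; so does g |-> g[x] for x in B, now by
   l-cancellativity. Hence a common element (x, t) of sigma_X<a> and sigma_X<b>,
   which says that t(a[x]) and t(b[x]) lie in the same class X, forces a and b to
   be congruent; and congruent elements have equal sigma_X. *)
Require Import Defs.
From mathcomp Require Import all_boot.
From mathcomp Require Import boolp classical_sets.

Local Open Scope classical_set_scope.

Section TranslationCompatibility.
Context {n : nat} {G : mengerAlgebra n} {rho : set (G * G)}.

(** Stability relates the two sides coordinatewise: reflexivity covers [u] and every coordinate
    other than [i]. *)
Lemma stable_mop_at (rho_refl : forall x, rho (x, x)) (rho_st : stable rho)
    (u : G) (w : {ffun 'I_n -> G}) (i : 'I_n) (x y : G) :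
  rho (x, y) -> rho (mop_at u w i x, mop_at u w i y).
Proof. by move=> xy; apply: rho_st => // j; rewrite !ffunE; case: ifP. Qed.

Lemma stable_Tn (rho_refl : forall x, rho (x, x)) (rho_st : stable rho)
    (t : G -> G) (x y : G) :
  Tn t -> rho (x, y) -> rho (t x, t y).
Proof.
by move=> Tt xy; elim: Tt => [//|i a b s _ IHs]; apply: stable_mop_at.
Qed.

Lemma stable_extmop (rho_refl : forall x, rho (x, x)) (rho_st : stable rho)
    (b : extvec G) (x y : G) :
  rho (x, y) -> rho (extmop x b, extmop y b).
Proof. by case: b => [z|] //= xy; apply: rho_st. Qed.

(** Induction on the construction of [t]: v-cancellativity strips the outermost operation. *)
Lemma v_cancellative_Tn (rho_v : v_cancellative rho) (t : G -> G) (x y : G) :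
  Tn t -> rho (t x, t y) -> rho (x, y).
Proof. by elim=> [//|i a b s _ IHs /rho_v/IHs]. Qed.

Lemma l_cancellative_extmop (rho_l : l_cancellative rho) (b : extvec G)
    (x y : G) :
  rho (extmop x b, extmop y b) -> rho (x, y).
Proof. by case: b => [z /rho_l|]. Qed.

End TranslationCompatibility.

Section CongruenceClass.
Context {n : nat} {G : mengerAlgebra n} {eps : set (G * G)} {X : set G}.
Hypotheses (eps_congr : congruence eps) (X_class : is_class eps X).

Lemma sigma_class_congr (a b : G) : eps (a, b) -> sigma X a = sigma X b.
Proof.
have [[eps_refl eps_sym eps_trans] eps_st] := eps_congr.
have [g ->] := X_class.
(* One inclusion is enough, since [eps] is symmetric. *)
suff sub c d : eps (c, d) ->
    sigma [set y | eps (g, y)] c `<=` sigma [set y | eps (g, y)] d.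
  by move=> ab; apply/seteqP; split; apply: sub => //; apply: eps_sym.
move=> cd [x t] /= [Tt gc]; split=> //=.
apply: eps_trans gc _.
by apply: stable_Tn => //; apply: stable_extmop.
Qed.

(** Serves twice: for bistrongness, and for recovering [eps] from [Prel X] outside [Wset X]. *)
Lemma sigma_class_meet (eps_lv : lv_cancellative eps) (a b : G) :
  sigma X a `&` sigma X b !=set0 -> eps (a, b).
Proof.
have [[_ eps_sym eps_trans] _] := eps_congr; have [eps_l eps_v] := eps_lv.
have [g ->] := X_class.
move=> [[x t] /= [[/= Tt ga] [_ /= gb]]].
apply: (l_cancellative_extmop eps_l x).
apply: (v_cancellative_Tn eps_v t _ _ Tt).
(* Both values are congruent to the representative [g] of the class. *)
exact: eps_trans (eps_sym _ _ ga) gb.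
Qed.

End CongruenceClass.

Theorem proposition4p10 (n : nat) (n_gt0 : (0 < n)%N) (G : mengerAlgebra n)
    (eps : set (G * G)) (eps_congr : congruence eps)
    (eps_lv : lv_cancellative eps) :
  forall X : set G, is_class eps X ->
    [/\ bistrong X,
        eps `<=` Prel X &
        eps `&` (~` Wset X `*` ~` Wset X)
        = Prel X `&` (~` Wset X `*` ~` Wset X)].
Proof.
move=> X X_class.
have epsP : eps `<=` Prel X.
  by move=> [a b]; apply: sigma_class_congr eps_congr X_class _ _.
split=> // [a b ab|].
  exact/(sigma_class_congr eps_congr X_class _ _)/(sigma_class_meet eps_congr X_class eps_lv).
apply/seteqP; split=> [p [/epsP]//|[a b] [/= Pab [/= aNW bNW]]]; split=> //.
apply: (sigma_class_meet eps_congr X_class eps_lv).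
(* As the two sets are equal, their intersection is [sigma X a], which is nonempty because [a] lies
   outside [Wset X]. *)
rewrite -[sigma X b]Pab setIid.
exact/set0P/eqP.
Qed.
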